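(* Assume $\|\dot m(Z_i,\hat\theta_n)\|>0$ for all $i=1,\dots,n$. Among all subsampling distributions $\{\pi_{n,i}\}_{i=1}^n$ with $\pi_{n,i}>0$, $\sum_{i=1}^n\pi_{n,i}=1$ and $\pi_{n,i}\le s_n^{-1}$, the trace $\mathrm{tr}\{\Lambda_{n,P}(\hat\theta_n)\}$, where $$\Lambda_{n,P}(\theta)=\frac1{n^2}\sum_{i=1}^n\frac{\dot m(Z_i,\theta)\dot m^{T}(Z_i,\theta)}{\pi_{n,i}}-\frac{s_n}{n^2}\sum_{i=1}^n\dot m(Z_i,\theta)\dot m^{T}(Z_i,\theta),$$ is minimized by $$\pi_{n,Pi}^{\mathrm{opt}}=\frac{\|\dot m(Z_i,\hat\theta_n)\|\wedge H}{\sum_{j=1}^n\{\|\dot m(Z_j,\hat\theta_n)\|\wedge H\}},\qquad i=1,\dots,n,$$ where $a\wedge b=\min(a,b)$, $$H=\frac{\sum_{i=1}^{n-g}\|\dot m(Z,\hat\theta_n)\|_{(i)}}{s_n-g},$$ $\|\dot m(Z,\hat\theta_n)\|_{(1)}\le\dots\le\|\dot m(Z,\hat\theta_n)\|_{(n)}$ are the order statistics of $\|\dot m(Z_1,\hat\theta_n)\|,\dots,\|\dot m(Z_n,\hat\theta_n)\|$, and $g\in\{0,\dots,s_n-1\}$ is an integer such that $$\frac{\|\dot m(Z,\hat\theta_n)\|_{(n-g)}}{\sum_{i=1}^{n-g}\|\dot m(Z,\hat\theta_n)\|_{(i)}}<\frac1{s_n-g}\quad\text{and}\quad\frac{\|\dot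 m(Z,\hat\theta_n)\|_{(n-g+1)}}{\sum_{i=1}^{n-g+1}\|\dot m(Z,\hat\theta_n)\|_{(i)}}\ge\frac1{s_n-g+1},$$ in which $\|\dot m(Z,\hat\theta_n)\|_{(n+1)}=\infty$ by definition (so that for $g=0$ the second inequality is regarded as satisfied). (These are the L-optimal subsampling probabilities with $L=\ddot M_n(\hat\theta_n)$ for the Poisson subsampling estimator.)
   Context: Data $Z_1,\dots,Z_n$ are given; $m(Z,\theta)$ is a real-valued function of $\theta\in\mathbb R^d$ with gradient $\dot m$ and Hessian $\ddot m$ in $\theta$; $\hat\theta_n$ is the maximizer of $M_n(\theta)=\frac1n\sum_{i=1}^n m(Z_i,\theta)$, and $\ddot M_n(\theta)=\frac1n\sum_{i=1}^n\ddot m(Z_i,\theta)$. $\|\cdot\|$ is the Euclidean norm. $s_n$ is the expected subsample size, a positive integer with $s_n<n$. Poisson subsampling includes each $Z_i$ independently with probability $s_n\pi_{n,i}$; the estimator is $\tilde\theta_{s_n,P}=\arg\max_\theta\sum_{i=1}^{s_n^*}\frac{m(Z_i^*,\theta)}{ns_n^*\pi_{n,i}^*}$ over the $s_n^*$ included data points $Z_i^*$ with corresponding probabilities $\pi_{n,i}^*$. Its (scaled) asymptotic variance matrix is $V_{n,P}(\hat\theta_n)=\ddot M_n^{-1}(\hat\theta_n)\Lambda_{n,P}(\hat\theta_n)\ddot M_n^{-1}(\hat\theta_n)$. For a matrix $L$, the L-optimality criterion is to choose $\{\pi_{n,i}\}$ to minimize $\mathrm{tr}\{LV_{n,P}(\hat\theta_n)L^{T}\}$;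 for $L=\ddot M_n(\hat\theta_n)$ this is $\mathrm{tr}\{\Lambda_{n,P}(\hat\theta_n)\}$. *)

(* Defs.v *)
From HB Require Import structures.
From mathcomp Require Import all_boot all_order all_algebra.
From mathcomp Require Import all_classical all_reals all_analysis.

Set Implicit Arguments.
Unset Strict Implicit.
Unset Printing Implicit Defensive.

Import Order.TTheory GRing.Theory Num.Theory.
Import numFieldNormedType.Exports.

Local Open Scope ring_scope.

Section Calculus.
Variables (R : realType) (d : nat).

(* The library norm `|v| on matrices is the sup norm, hence this definition;
   the two norms give the same notion of differentiability. *)
Definition enorm (v : 'cV[R]_d) : R := Num.sqrt (\sum_(i < d) v i 0 ^+ 2).

Definition gradient (f : 'cV[R]_d -> R) (theta : 'cV[R]_d) : 'cV[R]_d :=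
  \col_i 'D_(delta_mx i 0) f theta.

Definition hessian (f : 'cV[R]_d -> R) (theta : 'cV[R]_d) : 'M[R]_d :=
  \matrix_(i, j) 'D_(delta_mx j 0) (fun t => gradient f t i 0) theta.

Definition twice_differentiable (f : 'cV[R]_d -> R) : Prop :=
  (forall theta, differentiable f theta) /\
  (forall theta, differentiable (gradient f) theta).

End Calculus.

Section OrderStatistics.
Variables (R : realType) (n : nat).

(* The k-th smallest value of a, for 1 <= k <= n. *)
Definition order_stat (a : 'I_n -> R) (k : nat) : R :=
  nth 0 (sort <=%R [seq a i | i <- enum 'I_n]) k.-1.

Definition order_stat_sum (a : 'I_n -> R) (k : nat) : R :=
  \sum_(1 <= i < k.+1) order_stat a i.

(* The guard (0 < g)%N encodes the convention a_(n+1) = +oo, under which the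
   second inequality is void when g = 0. *)
Definition cap_index (s : nat) (a : 'I_n -> R) (g : nat) : Prop :=
  [/\ (g < s)%N,
      order_stat a (n - g) / order_stat_sum a (n - g) < (s - g)%:R^-1 &
      (0 < g)%N ->
      (s - g + 1)%:R^-1 <=
        order_stat a (n - g + 1) / order_stat_sum a (n - g + 1)].

Definition cap_level (s : nat) (a : 'I_n -> R) (g : nat) : R :=
  order_stat_sum a (n - g) / (s - g)%:R.

Definition capped_prob (s : nat) (a : 'I_n -> R) (g : nat) (i : 'I_n) : R :=
  Num.min (a i) (cap_level s a g) /
  \sum_(j < n) Num.min (a j) (cap_level s a g).

End OrderStatistics.

Section PoissonSubsampling.
Variables (R : realType) (T : Type) (d n : nat).
Variables (Z : 'I_n -> T) (m : T -> 'cV[R]_d -> R).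

Definition Mn (theta : 'cV[R]_d) : R :=
  n%:R^-1 * \sum_(i < n) m (Z i) theta.

Definition Mn_ddot (theta : 'cV[R]_d) : 'M[R]_d :=
  n%:R^-1 *: \sum_(i < n) hessian (m (Z i)) theta.

Definition grad_norm (theta : 'cV[R]_d) (i : 'I_n) : R :=
  enorm (gradient (m (Z i)) theta).

Definition score_outer (theta : 'cV[R]_d) (i : 'I_n) : 'M[R]_d :=
  gradient (m (Z i)) theta *m (gradient (m (Z i)) theta)^T.

Definition subsampling_distribution (s : nat) (p : 'I_n -> R) : Prop :=
  [/\ forall i, 0 < p i, \sum_(i < n) p i = 1 & forall i, p i <= s%:R^-1].

Definition LambdaP (s : nat) (theta : 'cV[R]_d) (p : 'I_n -> R) : 'M[R]_d :=
  (n%:R ^+ 2)^-1 *: (\sum_(i < n) (p i)^-1 *: score_outer theta i)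
  - (s%:R / n%:R ^+ 2) *: (\sum_(i < n) score_outer theta i).

(* Meaningful only when Mn_ddot theta is invertible, as invmx returns its
   argument on singular matrices. *)
Definition VP (s : nat) (theta : 'cV[R]_d) (p : 'I_n -> R) : 'M[R]_d :=
  invmx (Mn_ddot theta) *m LambdaP s theta p *m invmx (Mn_ddot theta).

Definition minimizes_among (F : ('I_n -> R) -> R) (s : nat)
    (p : 'I_n -> R) : Prop :=
  subsampling_distribution s p /\
  forall q, subsampling_distribution s q -> F p <= F q.

Definition L_optimal (s : nat) (theta : 'cV[R]_d) (L : 'M[R]_d)
    (p : 'I_n -> R) : Prop :=
  minimizes_among (fun q => \tr (L *m VP s theta q *m L^T)) s p.

End PoissonSubsampling.

(* Main.v *)
Require Import Defs.
From mathcomp Require Import all_boot all_order all_algebra.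
From mathcomp Require Import all_classical all_reals all_analysis.
From mathcomp Require Import ring lra zify.

Set Implicit Arguments.
Unset Strict Implicit.
Unset Printing Implicit Defensive.

Import Order.TTheory GRing.Theory Num.Theory.
Import numFieldNormedType.Exports.

Local Open Scope ring_scope.

(** Write a_i for the norm of the i-th gradient at theta_hat. The trace of
[LambdaP] is an increasing affine function of the sum of the a_i^2 / p_i, so
the problem is to minimize this sum over the probabilities bounded by 1/s.

Let H be the level [cap_level] and c = s H. The two inequalities defining g say
exactly that a_(n-g) < H <= a_(n-g+1): the cap at H leaves the n-g smallest
values alone and brings the g largest down to H. Hence the a_i `min` H add up
to (s-g) H + g H = c ([sum_min_cap_level]), and the candidate is
p_i = min(a_i, H) / c, which is at most 1/s because c = s H.

Its optimality is a Karush-Kuhn-Tucker argument, with c^2 as the multiplier of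
the constraint that the p_i sum to 1. By convexity of 1/x, a_i^2 / q_i lies
above its tangent at p_i, of slope -(a_i / p_i)^2. Where a_i <= H this slope is
-c^2. Where a_i > H it is steeper, but there p_i = 1/s is the largest allowed
value, so that q_i <= p_i. In both cases
a_i^2 / q_i >= a_i^2 / p_i - c^2 (q_i - p_i), and the last terms cancel in the
sum over i ([capped_prob_minimizes]). An index g exists because the first
inequality holds at g = s-1, and at the least g satisfying it the second
inequality is the failure of the first one at g-1 ([cap_index_ex]).

For the L-optimality criterion, M^-1 Lambda M^-1 is multiplied by M on the left
and by the transpose of M on the right, M being the average Hessian. This gives
back Lambda provided that M is symmetric, that is, provided that the mixed
second derivatives of a twice differentiable function commute. As the second
derivatives need not be continuous, this is proved with the second difference
f(x+tu+tv) - f(x+tu) - f(x+tv) + f(x), which is symmetric in u and v and whose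
quotient by t^2 tends to the mixed derivative ([second_difference_cvg]). *)

(** * Symmetry of second derivatives *)

Lemma is_derive_line (R : realType) (V : normedModType R) (f : V -> R)
    (x u : V) (r : R) :
  derivable f (x + r *: u) u ->
  is_derive r 1 (fun t : R => f (x + t *: u)) ('D_u f (x + r *: u)).
Proof.
have E : (fun h : R => h^-1 *: (f (x + (h *: 1 + r) *: u) - f (x + r *: u)))
     = (fun h : R => h^-1 *: (f (h *: u + (x + r *: u)) - f (x + r *: u))).
  by apply/funext => h; rewrite [_ *: 1]mulr1 scalerDl addrCA.
by move=> df; split; rewrite /derivable /derive /= E.
Qed.

(** By the mean value theorem, applied to r |-> f (x + tv + ru) - f (x + ru) on
[0, t], the second difference is t times an increment of 'D_u f between two
points at distance O(t) of x. Differentiability of 'D_u f at the single point x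
then evaluates this increment as t 'D_v ('D_u f) x, up to o(t). *)
Lemma second_difference_cvg (R : realType) (V : normedModType R) (f : V -> R)
    (x u v : V) :
  (forall y, derivable f y u) -> differentiable ('D_u f) x ->
  (((f (x + t *: v + t *: u) - f (x + t *: u)) - (f (x + t *: v) - f x)) / t ^+ 2
     @[t --> (0 : R)^'+] --> 'D_v ('D_u f) x)%classic.
Proof.
move=> df dF; rewrite (deriveE v dF).
apply/cvgrPdist_le => /= e e0.
(* K t bounds the sum of the distances to x of the two points, c u and
   t v + c u away from x with 0 < c < t; the summand 1 makes K positive. *)
pose K := `|u| *+ 2 + `|v| + 1.
have K0 : 0 < K by rewrite ltr_wpDl// addr_ge0// mulrn_wge0.
have eK0 : 0 < e / K by rewrite divr_gt0.
have Hd : \forall h \near (0 : V),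
    `|'D_u f (h + x) - ('D_u f x + 'd ('D_u f) x h)| <= e / K * `|h|.
  have /eqaddoP/(_ _ eK0) := diff_locally dF.
  by apply: filterS => h.
have [d /= d0 {}Hd] := (nbhs_ballP _ _).1 Hd.
have {}Hd h : `|h| < d ->
    `|'D_u f (h + x) - ('D_u f x + 'd ('D_u f) x h)| <= e / K * `|h|.
  by move=> hd; apply: Hd; rewrite -ball_normE /ball_/= sub0r normrN.
near=> t.
have t0 : 0 < t by near: t; exact: nbhs_right_gt.
have td : t * K < d.
  by rewrite -ltr_pdivlMr//; near: t; apply: nbhs_right_lt; rewrite divr_gt0.
pose g (r : R) := f ((x + t *: v) + r *: u) - f (x + r *: u).
have dg (r : R) : is_derive r 1 g
    ('D_u f ((x + t *: v) + r *: u) - 'D_u f (x + r *: u)).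
  by apply: is_deriveB; apply: is_derive_line; exact: df.
have [|c] := @MVT _ g _ 0 t t0 (fun r _ => dg r).
  by apply: derivable_within_continuous => r _; case: (dg r).
rewrite in_itv/= => /andP[c0 ct].
rewrite subr0 /g !scale0r !addr0 => ->.
have cu : `|c *: u| <= t * `|u| by rewrite normrZ gtr0_norm// ler_wpM2r// ltW.
have tv : `|t *: v| = t * `|v| by rewrite normrZ gtr0_norm.
have h1d : `|c *: u| < d.
  apply: le_lt_trans td; apply: (le_trans cu); rewrite ler_pM2l//.
  by rewrite /K mulr2n -!addrA lerDl !addr_ge0.
have h2 : `|t *: v + c *: u| <= t * (`|u| + `|v|).
  by rewrite (le_trans (ler_normD _ _))// tv mulrDr addrC lerD2r.
have h2d : `|t *: v + c *: u| < d.
  apply: le_lt_trans td; apply: (le_trans h2); rewrite ler_pM2l//.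
  by rewrite /K mulr2n; have := normr_ge0 u; lra.
set D1 := 'D_u f (x + t *: v + c *: u); set D2 := 'D_u f (x + c *: u).
set l : R := 'd ('D_u f) x v; pose w : R := 'd ('D_u f) x u.
pose D0 : R := 'D_u f x.
have dL p q : 'd ('D_u f) x (p + q) = 'd ('D_u f) x p + 'd ('D_u f) x q.
  exact: linearD.
have dZ r p : 'd ('D_u f) x (r *: p) = r * 'd ('D_u f) x p by exact: linearZ.
have A : `|D1 - (D0 + (t * l + c * w))| <= e / K * `|t *: v + c *: u|.
  have := Hd _ h2d; rewrite [_ + x]addrC addrA.
  by rewrite dL !dZ.
have B : `|D2 - (D0 + c * w)| <= e / K * `|c *: u|.
  by have := Hd _ h1d; rewrite [_ + x]addrC dZ.
have -> : l - (D1 - D2) * t / t ^+ 2 =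
    - ((D1 - (D0 + (t * l + c * w))) - (D2 - (D0 + c * w))) / t.
  by field; rewrite gt_eqF.
rewrite normrM normfV (gtr0_norm t0) ler_pdivrMr// normrN.
rewrite (le_trans (ler_normB _ _))// (le_trans (lerD A B))// -mulrDr.
have -> : e * t = e / K * (t * K) by field; rewrite gt_eqF.
rewrite ler_pM2l//; apply: le_trans (lerD h2 cu) _.
by rewrite -mulrDr ler_pM2l// /K mulr2n; lra.
Unshelve. all: by end_near.
Qed.

(** Exchanging u and v leaves the second difference unchanged, so its quotient
by t^2 has both mixed derivatives as limit. *)
Lemma derive_comm (R : realType) (V : normedModType R) (f : V -> R)
    (x u v : V) :
  (forall y, derivable f y u) -> (forall y, derivable f y v) ->
  differentiable ('D_u f) x -> differentiable ('D_v f) x ->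
  'D_v ('D_u f) x = 'D_u ('D_v f) x.
Proof.
move=> dfu dfv dFu dFv.
have cu := second_difference_cvg (v := v) dfu dFu.
have cv := second_difference_cvg (v := u) dfv dFv.
apply: (cvg_unique (@norm_hausdorff _ _) cu).
rewrite (_ : (fun t : R => _) = (fun t : R =>
  ((f (x + t *: u + t *: v) - f (x + t *: v)) - (f (x + t *: u) - f x))
    / t ^+ 2)) //.
apply/funext => t; rewrite (addrAC x); congr (_ / _).
by ring.
Qed.

Lemma hessian_sym (R : realType) (d : nat) (f : 'cV[R]_d -> R) (x : 'cV[R]_d) :
  twice_differentiable f -> (hessian f x)^T = hessian f x.
Proof.
move=> [df dg]; apply/matrixP => i j; rewrite !mxE.
have gE k : (fun t => gradient f t k 0) = 'D_(delta_mx k 0) f.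
  by apply/funext => t; rewrite mxE.
have dgk k : differentiable ('D_(delta_mx k 0) f) x.
  rewrite -gE; apply: (@differentiable_comp _ _ _ _ (gradient f)
    (fun N : 'cV[R]_d => N k 0)); [exact: dg|exact: differentiable_coord].
rewrite !gE; apply: derive_comm => // y; exact/diff_derivable.
Qed.

(** * Order statistics and the cap level *)

Section OrderStatisticsTheory.
Variables (R : realType) (n : nat) (a : 'I_n -> R).

Lemma size_sorted_values : size (sort <=%R [seq a i | i <- enum 'I_n]) = n.
Proof. by rewrite size_sort size_map size_enum_ord. Qed.

Lemma order_stat_le (j k : nat) :
  (0 < j)%N -> (j <= k)%N -> (k <= n)%N -> order_stat a j <= order_stat a k.
Proof.
move=> j0 jk kn.
apply: (sorted_leq_nth le_trans le_refl) => //; rewrite ?inE ?size_sorted_values.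
- exact/sort_sorted/le_total.
- by rewrite prednK// (leq_trans jk).
- by rewrite prednK// (leq_trans j0).
- by case: j k j0 jk {kn} => [|j] [|k].
Qed.

Lemma order_stat_gt0 (k : nat) :
  (forall i, 0 < a i) -> (0 < k <= n)%N -> 0 < order_stat a k.
Proof.
move=> a0 /andP[k0 kn].
have : order_stat a k \in sort <=%R [seq a i | i <- enum 'I_n].
  by apply: mem_nth; rewrite size_sorted_values prednK.
by rewrite mem_sort => /mapP[i _ ->].
Qed.

Lemma order_stat_sumS (k : nat) :
  order_stat_sum a k.+1 = order_stat_sum a k + order_stat a k.+1.
Proof. by rewrite /order_stat_sum big_nat_recr. Qed.

Lemma order_stat_sum_gt0 (k : nat) :
  (forall i, 0 < a i) -> (0 < k <= n)%N -> 0 < order_stat_sum a k.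
Proof.
move=> a0; elim: k => // k IH /= kn; rewrite order_stat_sumS.
have sk := order_stat_gt0 a0 (k := k.+1) kn.
case: k IH kn sk => [|k] IH kn sk.
  by rewrite /order_stat_sum big_nil add0r.
by rewrite addr_gt0// IH//; lia.
Qed.

Lemma sum_order_stat (F : R -> R) :
  \sum_(i < n) F (a i) = \sum_(1 <= k < n.+1) F (order_stat a k).
Proof.
rewrite big_add1/=.
transitivity (\sum_(x <- sort <=%R [seq a i | i <- enum 'I_n]) F x).
  rewrite (perm_big _ (permEl (perm_sort _ _)))/= big_map.
  by rewrite -[index_enum _]enumT.
by rewrite (big_nth 0) size_sorted_values.
Qed.

Section CapLevel.
Variables (s : nat).
Hypothesis s_lt_n : (s < n)%N.
Hypothesis a_gt0 : forall i, 0 < a i.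

(** The least g satisfying the first inequality satisfies the second one. *)
Lemma cap_index_ex : (0 < s)%N -> exists g, cap_index s a g.
Proof.
move=> s_gt0.
pose P g := order_stat a (n - g) / order_stat_sum a (n - g) < (s - g)%:R^-1.
(* At g = s-1 the inequality compares the last term of a sum of at least two
   positive terms with the sum itself; this is where s < n is used. *)
have Ps : P s.-1.
  rewrite /P.
  have -> : (s - s.-1 = 1)%N by lia.
  have -> : (n - s.-1 = (n - s).+1)%N by lia.
  rewrite invr1 ltr_pdivrMr ?mul1r; last by apply: order_stat_sum_gt0 => //; lia.
  by rewrite order_stat_sumS ltrDr; apply: order_stat_sum_gt0 => //; lia.
have [g Pg gmin] := @ex_minnP P (ex_intro P _ Ps).
exists g; split => // [|g0]; first by have := gmin _ Ps; lia.
rewrite leNgt; apply/negP => h; suff /gmin : P g.-1 by lia.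
rewrite /P; have -> : (n - g.-1 = n - g + 1)%N by have := gmin _ Ps; lia.
by have -> : (s - g.-1 = s - g + 1)%N by have := gmin _ Ps; lia.
Qed.

Variable (g : nat).
Hypothesis gP : cap_index s a g.

Lemma cap_level_gt0 : 0 < cap_level s a g.
Proof.
case: gP => gs _ _.
by rewrite divr_gt0 ?ltr0n ?subn_gt0// order_stat_sum_gt0//; lia.
Qed.

Lemma cap_level_gt : order_stat a (n - g) < cap_level s a g.
Proof.
case: gP => gs h _.
have S0 : 0 < order_stat_sum a (n - g) by apply: order_stat_sum_gt0 => //; lia.
by move: h; rewrite ltr_pdivrMr// mulrC.
Qed.

(** Multiplied out, the second inequality is
S_(n-g) + a_(n-g+1) <= (s - g + 1) a_(n-g+1), where S_k is the sum of the k
smallest values; one copy of a_(n-g+1) cancels. *)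
Lemma cap_level_le : (0 < g)%N -> cap_level s a g <= order_stat a (n - g + 1).
Proof.
case: gP => gs _ h g0; have {h} := h g0.
have S0 : 0 < order_stat_sum a (n - g + 1) by apply: order_stat_sum_gt0 => //; lia.
rewrite ler_pdivlMr// mulrC ler_pdivrMr ?ltr0n ?addn1// order_stat_sumS.
by rewrite /cap_level ler_pdivrMr ?ltr0n ?subn_gt0// -natr1 mulrDr mulr1 lerD2r.
Qed.

(** The n-g smallest values are below the cap and sum to (s-g) times it, by
definition of the level; each of the other g values contributes the cap. *)
Lemma sum_min_cap_level :
  \sum_(j < n) Num.min (a j) (cap_level s a g) = s%:R * cap_level s a g.
Proof.
have [gs _ _] := gP.
have sg0 : (s - g)%:R != 0 :> R by rewrite pnatr_eq0; lia.
rewrite (sum_order_stat (fun x => Num.min x (cap_level s a g))).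
rewrite (big_cat_nat _ (n := (n - g).+1))//=; last by lia.
rewrite (eq_big_nat _ _ (F2 := order_stat a)); last first.
  move=> k /andP[k0 kg]; apply/min_idPl.
  by apply: le_trans (ltW cap_level_gt); apply: order_stat_le => //; lia.
rewrite [X in _ + X](eq_big_nat _ _ (F2 := fun=> cap_level s a g)); last first.
  move=> k /andP[k0 kn]; apply/min_idPr.
  by apply: le_trans (cap_level_le _) _; [lia|apply: order_stat_le; lia].
rewrite sumr_const_nat -/(order_stat_sum a (n - g)).
have -> : order_stat_sum a (n - g) = (s - g)%:R * cap_level s a g.
  by rewrite mulrCA mulfV// mulr1.
rewrite -[cap_level _ _ _ *+ _]mulr_natl -mulrDl -natrD; congr (_%:R * _); lia.
Qed.

End CapLevel.
End OrderStatisticsTheory.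

(** * Optimality of the capped probabilities *)

Section CappedProbability.
Variables (R : realType) (n s g : nat) (a : 'I_n -> R).
Hypothesis s_lt_n : (s < n)%N.
Hypothesis a_gt0 : forall i, 0 < a i.
Hypothesis gP : cap_index s a g.

Let s_gt0 : (0 < s)%N. Proof. by case: gP => gs _ _; lia. Qed.

Lemma capped_probE i :
  capped_prob s a g i = Num.min (a i) (cap_level s a g) / (s%:R * cap_level s a g).
Proof. by rewrite /capped_prob sum_min_cap_level. Qed.

Lemma capped_prob_distribution : subsampling_distribution s (capped_prob s a g).
Proof.
have H0 := cap_level_gt0 s_lt_n a_gt0 gP.
have sR : 0 < s%:R :> R by rewrite ltr0n.
split=> [i||i].
- by rewrite capped_probE; apply: divr_gt0; [rewrite lt_min a_gt0|exact: mulr_gt0].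
- rewrite /capped_prob -mulr_suml sum_min_cap_level// mulfV//.
  by rewrite gt_eqF// mulr_gt0.
- rewrite capped_probE invfM mulrCA ler_piMr ?invr_ge0 ?ler0n//.
  by rewrite ler_pdivrMr// mul1r ge_min lexx orbT.
Qed.

(** The graph of the convex function x |-> b^2 / x lies above its tangent at p:
the difference is (b / p * (q - p))^2 / q. *)
Lemma sq_div_ge_tangent (b p q : R) : 0 < p -> 0 < q ->
  b ^+ 2 / p - (b / p) ^+ 2 * (q - p) <= b ^+ 2 / q.
Proof.
move=> p0 q0; rewrite -subr_ge0.
have -> : b ^+ 2 / q - (b ^+ 2 / p - (b / p) ^+ 2 * (q - p)) =
    (b / p * (q - p)) ^+ 2 / q by field; rewrite !gt_eqF.
by rewrite divr_ge0 ?sqr_ge0// ltW.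
Qed.

(** Each tangent slope -(a_i / p_i)^2 may be replaced by the common value -c^2:
the two agree below the cap, and above the cap the constraint q_i <= 1/s gives
q_i - p_i the right sign. The resulting linear terms sum to 0. *)
Lemma capped_prob_minimizes (q : 'I_n -> R) :
  subsampling_distribution s q ->
  \sum_(i < n) a i ^+ 2 / capped_prob s a g i <= \sum_(i < n) a i ^+ 2 / q i.
Proof.
move=> [q0 q1 qs]; have [p0 p1 _] := capped_prob_distribution.
have H0 := cap_level_gt0 s_lt_n a_gt0 gP.
have sR : 0 < s%:R :> R by rewrite ltr0n.
set c := s%:R * cap_level s a g.
have c0 : 0 < c by rewrite mulr_gt0.
suff h i : a i ^+ 2 / capped_prob s a g i
    <= a i ^+ 2 / q i + c ^+ 2 * (q i - capped_prob s a g i).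
  apply: le_trans (ler_sum _ (fun i _ => h i)) _.
  by rewrite big_split/= -mulr_sumr sumrB q1 p1 subrr mulr0 addr0.
rewrite -lerBlDr; apply: le_trans (sq_div_ge_tangent (a i) (p0 i) (q0 i)).
rewrite lerD2l lerN2; have [aH|Ha] := leP (a i) (cap_level s a g).
  have -> : a i / capped_prob s a g i = c.
    rewrite capped_probE (min_idPl aH) -/c.
    by field; rewrite !gt_eqF.
  by [].
have pE : capped_prob s a g i = s%:R^-1.
  by rewrite capped_probE (min_idPr (ltW Ha)); field; rewrite !gt_eqF.
apply: ler_wnM2r; first by rewrite pE subr_le0.
have apc : c <= a i / capped_prob s a g i.
  by rewrite pE invrK /c mulrC ler_pM2r// ltW.
by rewrite ler_sqr ?nnegrE ?(le_trans (ltW c0) apc)// ltW.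
Qed.

End CappedProbability.

(** * Traces of the variance matrices *)

Section Trace.
Variables (R : realType) (T : Type) (d n s : nat).
Variables (Z : 'I_n -> T) (m : T -> 'cV[R]_d -> R) (theta : 'cV[R]_d).

Lemma trace_outer (v : 'cV[R]_d) : \tr (v *m v^T) = enorm v ^+ 2.
Proof.
rewrite /enorm sqr_sqrtr ?sumr_ge0// => [|i _]; last exact: sqr_ge0.
by apply: eq_bigr => i _; rewrite !mxE big_ord1 mxE -expr2.
Qed.

Lemma trace_LambdaP (p : 'I_n -> R) :
  \tr (LambdaP Z m s theta p) =
  (n%:R ^+ 2)^-1 * \sum_(i < n) grad_norm Z m theta i ^+ 2 / p i
  - s%:R / n%:R ^+ 2 * \sum_(i < n) grad_norm Z m theta i ^+ 2.
Proof.
rewrite /LambdaP raddfB/= !mxtraceZ !raddf_sum/=.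
congr (_ * _ - _ * _); apply: eq_bigr => i _.
  by rewrite mxtraceZ trace_outer mulrC.
by rewrite trace_outer.
Qed.

Lemma Mn_ddot_sym : (forall z, twice_differentiable (m z)) ->
  (Mn_ddot Z m theta)^T = Mn_ddot Z m theta.
Proof.
move=> md; rewrite /Mn_ddot linearZ/= raddf_sum/=; congr (_ *: _).
by apply: eq_bigr => i _; exact: hessian_sym.
Qed.

Lemma trace_VP (p : 'I_n -> R) : (forall z, twice_differentiable (m z)) ->
  Mn_ddot Z m theta \in unitmx ->
  \tr (Mn_ddot Z m theta *m VP Z m s theta p *m (Mn_ddot Z m theta)^T) =
  \tr (LambdaP Z m s theta p).
Proof.
move=> md Mu; rewrite Mn_ddot_sym// /VP -!mulmxA mulKVmx// mulVmx//.
by rewrite mulmx1.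
Qed.

End Trace.

Theorem theorem4 (R : realType) (T : Type) (d n s : nat)
    (Z : 'I_n -> T) (m : T -> 'cV[R]_d -> R) (theta_hat : 'cV[R]_d)
    (s_gt0 : (0 < s)%N) (s_lt_n : (s < n)%N)
    (m_diff : forall z : T, twice_differentiable (m z))
    (theta_max : forall theta : 'cV[R]_d, Mn Z m theta <= Mn Z m theta_hat)
    (grad_pos : forall i : 'I_n, 0 < enorm (gradient (m (Z i)) theta_hat)) :
  (exists g : nat, cap_index s (grad_norm Z m theta_hat) g) /\
  (forall g : nat, cap_index s (grad_norm Z m theta_hat) g ->
     minimizes_among (fun p : 'I_n -> R => \tr (LambdaP Z m s theta_hat p)) s
       (capped_prob s (grad_norm Z m theta_hat) g) /\
     (Mn_ddot Z m theta_hat \in unitmx ->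
      L_optimal Z m s theta_hat (Mn_ddot Z m theta_hat)
        (capped_prob s (grad_norm Z m theta_hat) g))).
Proof.
split=> [|g gP]; first exact: cap_index_ex.
have optP : minimizes_among (fun p => \tr (LambdaP Z m s theta_hat p)) s
    (capped_prob s (grad_norm Z m theta_hat) g).
  split=> [|q qP]; first exact: capped_prob_distribution.
  rewrite !trace_LambdaP lerD2r ler_wpM2l ?invr_ge0 ?sqr_ge0//.
  exact: capped_prob_minimizes.
split=> // Mu; case: optP => pP pmin; split=> // q qP.
by rewrite !trace_VP//; exact: pmin.
Qed.
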